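(* Let $H$ be a Ramsey-Sidorenko graph and let $s$ be a positive integer. Then the join $\overline{K_s}\vee H$ is Ramsey-Sidorenko, and $$a_0(\overline{K_s}\vee H)\ \geq\ \frac{a_0(H)}{1+s\,a_0(H)}.$$
   Context: All graphs are finite and simple. $v(H)$ and $e(H)$ denote the numbers of vertices and edges of $H$; $\alpha(G)$ is the independence number of $G$; $\hom(H,G)$ is the number of graph homomorphisms from $H$ to $G$, i.e. maps $V(H)\to V(G)$ sending edges to edges. $\overline{K_s}$ is the graph with $s$ vertices and no edges. The join $H_1\vee H_2$ is the graph obtained from the disjoint union of $H_1$ and $H_2$ by adding all edges between $V(H_1)$ and $V(H_2)$. For a graph $H$ with at least one edge and a real number $a>0$, say that $H$ satisfies property $RS(a)$ if there is a constant $C_H>0$ such that for every $n\ge 1$ and every graph $G$ of order $n$, $$\alpha(G)\geq C_H\min\left\{n^{a},\left(\frac{n^{v(H)}}{\hom(H,G)}\right)^{1/e(H)}\right\},$$ where the second term is read as $+\infty$ if $\hom(H,G)=0$. $H$ is Ramsey-Sidorenko if it satisfies $RS(a)$ for some $a>0$. The Ramsey-Sidorenko threshold $a_0(H)$ of a Ramsey-Sidorenko graph $H$ is the supremum of all $a\leq 1$ such that $H$ satisfies $RS(a)$. *)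

(* Defs.v *)
From mathcomp Require Import all_boot all_order all_algebra.
From mathcomp Require Import all_classical all_reals all_analysis.

Set Implicit Arguments.
Unset Strict Implicit.
Unset Printing Implicit Defensive.

Import Order.TTheory GRing.Theory Num.Theory.

Local Open Scope ring_scope.

Record sgraph := SGraph {
  vert :> finType;
  adj : rel vert;
  adj_sym : symmetric adj;
  adj_irr : irreflexive adj }.

(* An edge is an unordered pair, so that each edge is counted once in [ecard]. *)
Definition edges (H : sgraph) : {set {set H}} :=
  [set A : {set H} | [exists x, exists y, adj x y && (A == [set x; y]%SET)]]%SET.

Definition vcard (H : sgraph) : nat := #|H|.
Definition ecard (H : sgraph) : nat := #|edges H|.

Definition independent (G : sgraph) (S : {set G}) : bool :=
  [forall x in S, forall y in S, ~~ adj x y].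

Definition indep_num (G : sgraph) : nat :=
  \max_(S : {set G} | independent S) #|S|.

Definition is_hom (H G : sgraph) (f : {ffun H -> G}) : bool :=
  [forall x, forall y, adj x y ==> adj (f x) (f y)].

Definition hom_num (H G : sgraph) : nat :=
  #|[set f : {ffun H -> G} | is_hom f]%SET|.

Definition empty_adj (s : nat) : rel 'I_s := fun _ _ => false.

Fact empty_adj_sym (s : nat) : symmetric (@empty_adj s).
Proof. by []. Qed.

Fact empty_adj_irr (s : nat) : irreflexive (@empty_adj s).
Proof. by []. Qed.

Definition empty_graph (s : nat) : sgraph :=
  SGraph (@empty_adj_sym s) (@empty_adj_irr s).

Definition join_adj (H1 H2 : sgraph) : rel (H1 + H2)%type := fun u v =>
  match u, v with
  | inl x, inl y => adj x y
  | inr x, inr y => adj x y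
  | _, _ => true
  end.

Fact join_adj_sym (H1 H2 : sgraph) : symmetric (@join_adj H1 H2).
Proof. by move=> [x|x] [y|y] //=; apply: adj_sym. Qed.

Fact join_adj_irr (H1 H2 : sgraph) : irreflexive (@join_adj H1 H2).
Proof. by move=> [x|x] /=; apply: adj_irr. Qed.

Definition join (H1 H2 : sgraph) : sgraph :=
  SGraph (@join_adj_sym H1 H2) (@join_adj_irr H1 H2).

Section RamseySidorenko.
Variable R : realType.

Definition hom_density_term (H G : sgraph) : \bar R :=
  if hom_num H G == 0%N then +oo%E
  else (((vcard G)%:R ^+ vcard H / (hom_num H G)%:R)
          `^ ((ecard H)%:R^-1))%:E.

(* Meant for [H] with at least one edge and [0 < a]; these conditions are
   imposed in [Ramsey_Sidorenko] and [RS_threshold]. *)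
Definition RS (H : sgraph) (a : R) : Prop :=
  exists2 C : R, 0 < C &
    forall n : nat, (0 < n)%N -> forall G : sgraph, vcard G = n ->
      (C%:E * Order.min (n%:R `^ a)%:E (hom_density_term H G)
         <= (indep_num G)%:R%:E)%E.

Definition Ramsey_Sidorenko (H : sgraph) : Prop :=
  (0 < ecard H)%N /\ exists2 a : R, 0 < a & RS H a.

(* If [H] is Ramsey-Sidorenko, this set is nonempty: [RS H a] with [1 <= a]
   implies [RS H 1]. *)
Definition RS_threshold (H : sgraph) : R :=
  sup [set a : R | [/\ 0 < a, a <= 1 & RS H a]]%classic.

End RamseySidorenko.

(* Main.v *)
Require Import Defs.
From mathcomp Require Import all_boot all_order all_algebra.
From mathcomp Require Import all_classical all_reals all_analysis.
From mathcomp Require Import ring lra zify.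

Import Order.TTheory GRing.Theory Num.Theory.
Local Open Scope ring_scope.

(** Write [alpha] for the independence number of a graph [G] of order [n],
    [v] and [e] for the numbers of vertices and edges of [H], and [J] for the
    join of [s] independent vertices with [H].

    Up to the constant, [RS H a] is a dichotomy ([RS_dichotomy]): either
    [alpha] is at least of order [n ^ a], or [hom(H, G) * alpha ^ e] is at least
    of order [n ^ v].  Assuming it for [H], the dichotomy for [J] with exponent
    [b = a / (1 + s a)] is obtained by applying the one for [H] inside the common
    neighbourhoods [N(x)] of the [s]-tuples [x] of vertices of [G].

    If [n < 2 alpha], then [alpha] is linear in [n] and there is nothing to do.
    Otherwise few vertices have degree much smaller than [n / alpha]
    ([card_low_degree]), so counting stars with [s] leaves shows that the average
    of [|N(x)|] is at least [2 t], where [t] is of order [n / alpha ^ s]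
    ([common_nbrs_dense]).  Compare [t ^ a] with [alpha].

    - If [alpha] is at least of order [t ^ a], then solving for [alpha] gives
      [alpha] at least of order [n ^ b].
    - If not, then every [N(x)] with more than [t] vertices falls in the second
      case of the dichotomy, so it contains at least of order
      [|N(x)| ^ v / alpha ^ e] copies of [H].  A copy of [H] inside [N(x)]
      together with [x] is a copy of [J] ([hom_num_join_empty_ge]); summing over
      [x] gives [hom(J, G) * alpha ^ e] at least of order [t ^ v * n ^ s]
      ([hom_num_join_large_nbrs]), that is, [hom(J, G) * alpha ^ (e + s v)] at
      least of order [n ^ (v + s)], and [J] has at least [e + s v] edges
      ([ecard_join_empty_ge]).

    The inequality between thresholds follows without any continuity argument:
    with [a0] and [b0] the thresholds of [H] and [J], each [a] admissible for [H]
    satisfies [a <= b0 (1 + s a) <= b0 (1 + s a0)], hence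
    [a0 <= b0 (1 + s a0)]. *)

(** * Degrees, common neighbourhoods and homomorphisms from a join *)

Section Combinatorics.
Set Implicit Arguments.
Unset Strict Implicit.
Local Open Scope nat_scope.
Local Open Scope set_scope.
Import mathcomp.boot.finset.

Definition induced_adj (G : sgraph) (A : {set G}) : rel {x : G | x \in A} :=
  fun x y => adj (val x) (val y).

Fact induced_adj_sym (G : sgraph) (A : {set G}) : symmetric (@induced_adj G A).
Proof. by move=> x y; apply: adj_sym. Qed.

Fact induced_adj_irr (G : sgraph) (A : {set G}) :
  irreflexive (@induced_adj G A).
Proof. by move=> x; apply: adj_irr. Qed.

Definition induced (G : sgraph) (A : {set G}) : sgraph :=
  SGraph (@induced_adj_sym G A) (@induced_adj_irr G A).

Lemma vcard_induced (G : sgraph) (A : {set G}) : vcard (induced A) = #|A|.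
Proof. by rewrite /vcard card_sig; apply: eq_card. Qed.

Lemma independentP (G : sgraph) (S : {set G}) :
  reflect {in S &, forall x y, ~~ adj x y} (independent S).
Proof.
apply: (iffP forall_inP) => [H x y xS yS|H x xS].
  by have /forall_inP -> := H x xS.
by apply/forall_inP => y yS; apply: H.
Qed.

Lemma independent_indep_num (G : sgraph) (S : {set G}) :
  independent S -> #|S| <= indep_num G.
Proof.
by move=> indS; apply: (leq_bigmax_cond (F := fun S : {set G} => #|S|)).
Qed.

Lemma indep_num_induced (G : sgraph) (A : {set G}) :
  indep_num (induced A) <= indep_num G.
Proof.
apply/bigmax_leqP => S /independentP indS.
rewrite -(card_imset _ val_inj); apply: independent_indep_num.
apply/independentP => _ _ /imsetP[x xS ->] /imsetP[y yS ->].
exact: indS.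
Qed.

Lemma indep_num_gt0 (G : sgraph) : 0 < vcard G -> 0 < indep_num G.
Proof.
move=> /card_gt0P[x _]; rewrite -(cards1 x); apply: independent_indep_num.
by apply/independentP => y z /set1P-> /set1P->; rewrite adj_irr.
Qed.

Definition degree (G : sgraph) (x : G) : nat := #|[set y | adj x y]|.

(** A maximal independent set of low-degree vertices dominates all the
    low-degree vertices, and each of its members dominates at most [k] vertices,
    itself included. *)
Lemma card_low_degree (G : sgraph) (k : nat) :
  #|[set x : G | degree x < k]| <= indep_num G * k.
Proof.
set L := [set x : G | degree x < k].
pose P (S : {set G}) := independent S && (S \subset L).
have P0 : P set0.
  by rewrite /P sub0set andbT; apply/independentP => x y; rewrite inE.
have [S /maxsetP[/andP[indS SL] maxS] _] := maxset_exists P0.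
have LS : L \subset \bigcup_(x in S) (x |: [set y | adj x y]).
  apply/fintype.subsetP => y yL; apply/bigcupP.
  have [yS|yNS] := boolP (y \in S); first by exists y; rewrite // !inE eqxx.
  have /exists_inP[x xS xy] : [exists x in S, adj x y].
    apply: contraNT yNS => /exists_inPn noadj.
    rewrite -(maxS (y |: S)) ?setU11 ?subsetUr// /P subUset sub1set yL SL.
    rewrite !andbT.
    apply/independentP => u v /setU1P[->|uS] /setU1P[->|vS].
    - by rewrite adj_irr.
    - by rewrite adj_sym noadj.
    - by rewrite noadj.
    - by move/independentP: indS; apply.
  by exists x; rewrite // !inE xy orbT.
apply: leq_trans (leq_mul (independent_indep_num indS) (leqnn k)).
apply: leq_trans (subset_leq_card LS) _.
rewrite -sum_nat_const; elim/big_ind2: _ => [|m A n B Am Bn|x xS].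
- by rewrite cards0.
- by rewrite (leq_trans (leq_card_setU A B).1)// leq_add.
- have := fintype.subsetP SL x xS; rewrite !inE => /(leq_trans _); apply.
  by rewrite cardsU1 addnC -addn1 leq_add2l leq_b1.
Qed.

Definition common_nbrs (G : sgraph) (s : nat) (x : {ffun 'I_s -> G}) :
    {set G} :=
  [set y | [forall i, adj (x i) y]].

(** Double counting of the stars whose leaves are listed, possibly with
    repetition, by [x]. *)
Lemma sum_card_common_nbrs (G : sgraph) (s : nat) :
  \sum_(x : {ffun 'I_s -> G}) #|common_nbrs x| = \sum_(y : G) degree y ^ s.
Proof.
transitivity (\sum_(x : {ffun 'I_s -> G}) \sum_y 
  (if y \in common_nbrs x then 1 else 0)).
  by apply: eq_bigr => x _; rewrite -sum1_card big_mkcond; apply: eq_bigr.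
rewrite exchange_big /=; apply: eq_bigr => y _.
rewrite -big_mkcond sum1_card -[in RHS](card_ord s) -card_ffun_on.
apply: eq_card => x; 
  rewrite [LHS](_ : _ = (y \in common_nbrs x))// inE.
apply/fintype.forallP/ffun_onP => xy i.
  by rewrite inE adj_sym.
by have := xy i; rewrite inE adj_sym.
Qed.

(** At least half of the vertices have degree at least [k], because those of
    lower degree are few. *)
Lemma sum_card_common_nbrs_ge (G : sgraph) (s k : nat) :
  2 * (indep_num G * k) <= vcard G ->
  vcard G * k ^ s <= 2 * \sum_(x : {ffun 'I_s -> G}) #|common_nbrs x|.
Proof.
move=> small; rewrite sum_card_common_nbrs.
set L := [set x : G | degree x < k].
have Lcard : 2 * #|L| <= vcard G.
  by apply: leq_trans small; rewrite leq_mul2l card_low_degree.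
have hD : vcard G <= 2 * #|~: L|.
  by rewrite -(leq_add2l (2 * #|L|)) -mulnDr cardsC [2 * #|G|]mul2n -addnn
    leq_add2r.
apply: leq_trans (leq_mul hD (leqnn (k ^ s))) _; rewrite -mulnA leq_mul2l /=.
rewrite -sum_nat_const [leqRHS](bigID (mem (~: L))) /=.
apply: leq_trans (leq_addr _ _); apply: leq_sum => y.
rewrite !inE -leqNgt => ky; by case: (s) => // s'; rewrite leq_exp2r.
Qed.

Lemma vcard_join_empty (s : nat) (H : sgraph) :
  vcard (join (empty_graph s) H) = s + vcard H.
Proof. by rewrite /vcard card_sum card_ord. Qed.

Lemma ecard_gt0_vcard (H : sgraph) : 0 < ecard H -> 0 < vcard H.
Proof.
move=> /card_gt0P[A]; rewrite inE => /existsP[x _].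
by apply/card_gt0P; exists x.
Qed.

(** As the independence number of a nonempty graph is at least [1], this also
    compares its powers with these exponents. *)
Lemma ecard_join_empty_ge (s : nat) (H : sgraph) :
  ecard H + s * vcard H <= ecard (join (empty_graph s) H).
Proof.
pose J := join (empty_graph s) H.
pose inlJ (i : 'I_s) : J := inl i.
pose inrJ (x : H) : J := inr x.
have inrJ_inj : injective inrJ by move=> x y [].
pose E1 : {set {set J}} := [set inrJ @: (A : {set H}) | A in edges H].
pose pr (p : 'I_s * H) : {set J} := [set inlJ p.1; inrJ p.2].
have pr_inj : injective pr.
  move=> [i x] [j y] /setP eqp.
  have := eqp (inlJ i); have := eqp (inrJ x); rewrite !inE !eqxx ?orbT /=.
  by move=> /esym/eqP[->] /esym; rewrite orbF => /eqP[->].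
pose E2 : {set {set J}} := [set pr p | p : 'I_s * H].
have cE1 : #|E1| = ecard H by apply: card_imset; apply: imset_inj.
have cE2 : #|E2| = s * vcard H.
  by rewrite card_imset// card_prod card_ord.
have dis : [disjoint E1 & E2].
  apply/pred0P => A /=; apply/negP => /andP[/imsetP[B _ ->]].
  move=> /imsetP[[i x] _] /setP /(_ (inlJ i)); rewrite !inE eqxx /=.
  by move=> /imsetP[].
rewrite -(leq_card_setU E1 E2).2 in dis.
rewrite -cE1 -cE2 -(eqP dis); apply: subset_leq_card.
rewrite subUset; apply/andP; split.
  apply/fintype.subsetP => _ /imsetP[A + ->]; rewrite !inE.
  move=> /existsP[x /existsP[y]].
  move=> /andP[xy /eqP->]; apply/existsP; exists (inrJ x).
  apply/existsP; exists (inrJ y); apply/andP; split=> //.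
  by rewrite imsetU1 imset_set1.
apply/fintype.subsetP => _ /imsetP[[i x] _ ->]; rewrite inE.
by apply/existsP; exists (inlJ i); apply/existsP; exists (inrJ x); rewrite eqxx.
Qed.

(** A homomorphism from the join consists of the images of the independent
    vertices and a homomorphism from [H] into their common neighbourhood. *)
Lemma hom_num_join_empty_ge (s : nat) (H G : sgraph) :
  \sum_(x : {ffun 'I_s -> G}) hom_num H (induced (common_nbrs x)) <=
  hom_num (join (empty_graph s) H) G.
Proof.
pose J := join (empty_graph s) H.
pose restr (f : {ffun J -> G}) : {ffun 'I_s -> G} := [ffun i => f (inl i)].
rewrite /hom_num -[leqRHS]sum1_card (partition_big restr predT)//=.
apply: leq_sum => x _; rewrite sum1dep_card.
pose ext (g : {ffun H -> induced (common_nbrs x)}) : {ffun J -> G} :=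
  [ffun u : J => match u with inl i => x i | inr h => val (g h) end].
have ext_inj : injective ext.
  move=> g1 g2 /ffunP eqg; apply/ffunP => h; apply: val_inj.
  by have := eqg (inr h); rewrite !ffunE.
rewrite -(card_imset _ ext_inj); apply: subset_leq_card.
apply/fintype.subsetP => _ /imsetP[g + ->]; rewrite !inE => homg.
apply/andP; split; last by apply/eqP/ffunP => i; rewrite !ffunE.
have nbr i h : adj (x i) (val (g h)).
  by have := valP (g h); rewrite inE => /forallP.
apply/forallP => u; apply/forallP => v; rewrite !ffunE.
case: u v => [i|h] [j|h'] /=.
- by [].
- by rewrite nbr.
- by rewrite adj_sym nbr.
- by move/forallP: homg => /(_ h) /forallP /(_ h').
Qed.

End Combinatorics.

(** * The Ramsey-Sidorenko property of the join *)

Section Thresholds.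
Set Implicit Arguments.
Unset Strict Implicit.
Context {R : realType}.

(** Both terms of the minimum are removed: the root of order [ecard H] is cleared
    by raising to the power [ecard H], and the convention for a vanishing
    [hom_num H G] takes care of itself, since the second alternative is then
    impossible. *)
Lemma RS_dichotomy (H : sgraph) (a : R) : (0 < ecard H)%N ->
  RS H a <->
  exists2 c : R, 0 < c & forall G : sgraph, (0 < vcard G)%N ->
    c * (vcard G)%:R `^ a <= (indep_num G)%:R \/
    c * (vcard G)%:R ^+ vcard H <=
      (hom_num H G)%:R * (indep_num G)%:R ^+ ecard H.
Proof.
move=> e_gt0; have e_neq0 : (ecard H)%:R != 0 :> R by rewrite pnatr_eq0 -lt0n.
have rootK (x : R) : 0 <= x -> (x `^ (ecard H)%:R^-1) ^+ ecard H = x.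
  by move=> x0; rewrite -powR_mulrn ?powR_ge0// -powRrM mulVf// powRr1.
have expK (x : R) : 0 <= x -> (x ^+ ecard H) `^ (ecard H)%:R^-1 = x.
  by move=> x0; rewrite -powR_mulrn// -powRrM mulfV// powRr1.
split=> -[c c_gt0 hc].
  exists (Num.min c (c ^+ ecard H)) => [|G n_gt0].
    by rewrite lt_min c_gt0 exprn_gt0.
  have cle : Num.min c (c ^+ ecard H) <= c by rewrite ge_min lexx.
  have cele : Num.min c (c ^+ ecard H) <= c ^+ ecard H.
    by rewrite ge_min lexx orbT.
  have := hc _ n_gt0 G erefl; rewrite [Order.min _%:E _]/Order.min.
  case: ifPn => [_|].
    rewrite -EFinM lee_fin => h; left; apply: le_trans h.
    by rewrite ler_wpM2r ?powR_ge0.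
  rewrite /hom_density_term; case: ifPn => [|hom_neq0 _]; first by rewrite ltry.
  have hom_gt0 : 0 < (hom_num H G)%:R :> R by rewrite ltr0n lt0n.
  rewrite -EFinM lee_fin => h; right.
  have q_ge0 : 0 <= (vcard G)%:R ^+ vcard H / (hom_num H G)%:R :> R.
    by rewrite divr_ge0// exprn_ge0.
  have : c ^+ ecard H * ((vcard G)%:R ^+ vcard H / (hom_num H G)%:R) <=
      (indep_num G)%:R ^+ ecard H.
    rewrite -(rootK _ q_ge0) -exprMn lerXn2r ?nnegrE ?mulr_ge0 ?powR_ge0//.
    exact: ltW.
  rewrite mulrA ler_pdivrMr// [leRHS]mulrC; apply: le_trans.
  by rewrite ler_wpM2r ?exprn_ge0.
exists (Num.min c (c `^ (ecard H)%:R^-1)) => [|n + G eqn].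
  by rewrite lt_min c_gt0 powR_gt0.
rewrite -{}eqn => n_gt0.
set C := Num.min c _.
have C_ge0 : 0 <= C by rewrite le_min (ltW c_gt0) powR_ge0.
have [hl|hr] := hc G n_gt0.
  apply: le_trans (_ : (C%:E * ((vcard G)%:R `^ a)%:E <= _)%E).
    by rewrite lee_wpmul2l ?lee_fin// ge_min lexx.
  rewrite -EFinM lee_fin; apply: le_trans hl.
  by rewrite ler_wpM2r ?powR_ge0// ge_min lexx.
have hom_gt0 : 0 < (hom_num H G)%:R :> R.
  rewrite lt_neqAle eq_sym ler0n andbT; apply/eqP => hom0.
  move: hr; rewrite hom0 mul0r leNgt mulr_gt0// exprn_gt0// ltr0n//.
apply: le_trans (_ : (C%:E * hom_density_term R H G <= _)%E).
  by rewrite lee_wpmul2l ?lee_fin// ge_min lexx orbT.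
rewrite /hom_density_term; case: ifPn => [/eqP hom0|_].
  by rewrite hom0 ltxx in hom_gt0.
have q_ge0 : 0 <= (vcard G)%:R ^+ vcard H / (hom_num H G)%:R :> R.
  by rewrite divr_ge0// exprn_ge0.
rewrite -EFinM lee_fin.
apply: le_trans (_ : c `^ (ecard H)%:R^-1 * _ <= _).
  by apply: ler_wpM2r; rewrite ?powR_ge0// ge_min lexx orbT.
rewrite -powRM ?(ltW c_gt0)// -[leRHS]expK//.
rewrite ge0_ler_powR ?nnegrE ?invr_ge0 ?exprn_ge0 ?mulr_ge0 ?(ltW c_gt0)//.
by rewrite mulrA ler_pdivrMr// [leRHS]mulrC.
Qed.

Lemma RS_le (H : sgraph) (a b : R) : (0 < ecard H)%N -> b <= a ->
  RS H a -> RS H b.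
Proof.
move=> e_gt0 ba /(RS_dichotomy _ e_gt0)[c c_gt0 hc].
apply/(RS_dichotomy _ e_gt0); exists c => // G n_gt0.
have [hl|hr] := hc G n_gt0; [left|by right].
apply: le_trans hl; rewrite ler_pM2l//; apply: ler_powR => //.
by rewrite ler1n.
Qed.


(** For the tuples whose common neighbourhood has [N > t] vertices, [small]
    excludes the first alternative, so the second one bounds their contribution
    from below.  As [N ^ v >= t ^ (v - 1) * (N - t)], and the right-hand side is
    nonpositive when [N <= t], the resulting linear bound can be summed over all
    tuples; it takes the place of a convexity inequality for [N ^ v]. *)
Lemma hom_num_join_large_nbrs (H G : sgraph) (s : nat) (a c t : R) :
  (0 < vcard H)%N -> 0 <= a -> 0 < c -> 0 < t ->
  (forall A : {set G}, (0 < #|A|)%N ->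
    c * #|A|%:R `^ a <= (indep_num G)%:R \/
    c * #|A|%:R ^+ vcard H <=
      (hom_num H (induced A))%:R * (indep_num G)%:R ^+ ecard H) ->
  (indep_num G)%:R < c * t `^ a ->
  2 * t * (vcard G)%:R ^+ s <=
    \sum_(x : {ffun 'I_s -> G}) #|common_nbrs x|%:R ->
  c * t ^+ vcard H * (vcard G)%:R ^+ s <=
    (hom_num (join (empty_graph s) H) G)%:R * (indep_num G)%:R ^+ ecard H.
Proof.
move=> v_gt0 a_ge0 c_gt0 t_gt0 dich small dense.
have t_ge0 := ltW t_gt0.
have term (x : {ffun 'I_s -> G}) :
    c * t ^+ (vcard H).-1 * (#|common_nbrs x|%:R - t) <=
    (hom_num H (induced (common_nbrs x)))%:R * (indep_num G)%:R ^+ ecard H.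
  have [Nt|tN] := leP #|common_nbrs x|%:R t.
    apply: le_trans (_ : 0 <= _); last by rewrite mulr_ge0// exprn_ge0.
    by rewrite mulr_ge0_le0 ?subr_le0// mulr_ge0 ?exprn_ge0// ltW.
  have N_gt0 : (0 < #|common_nbrs x|)%N.
    by rewrite -(ltr0n R) (lt_trans t_gt0).
  have [hl|] := dich _ N_gt0.
    have := le_lt_trans hl small; rewrite ltr_pM2l// ltNge.
    by rewrite ge0_ler_powR ?nnegrE// ltW.
  apply: le_trans; rewrite -mulrA ler_pM2l// -[in leRHS](prednK v_gt0) exprSr.
  apply: ler_pM; rewrite ?exprn_ge0 ?subr_ge0 ?(ltW tN)//.
    by rewrite lerXn2r ?nnegrE// ltW.
  by rewrite gerBl.
apply: le_trans (_ : (\sum_(x : {ffun 'I_s -> G})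
    (hom_num H (induced (common_nbrs x)))%:R) *
    (indep_num G)%:R ^+ ecard H <= _); last first.
  rewrite ler_wpM2r ?exprn_ge0// -natr_sum ler_nat.
  exact: hom_num_join_empty_ge.
rewrite mulr_suml; apply: le_trans (ler_sum _ (fun x _ => term x)).
rewrite -mulr_sumr sumrB sumr_const card_ffun card_ord -/(vcard G).
rewrite -[in leLHS](prednK v_gt0) exprSr !mulrA -!(mulrA (c * _)).
rewrite ler_pM2l ?mulr_gt0 ?exprn_gt0// -[t *+ _]mulr_natr natrX.
by rewrite lerBrDr; apply: le_trans dense; rewrite -mulrA mulrDl mul1r.
Qed.

(** [sum_card_common_nbrs_ge] for the largest admissible [k], which is at least
    [n / (4 alpha)]. *)
Lemma common_nbrs_dense (G : sgraph) (s : nat) :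
  (2 * indep_num G <= vcard G)%N ->
  2 * ((vcard G)%:R / (4 * (4 * (indep_num G)%:R) ^+ s)) * (vcard G)%:R ^+ s <=
    \sum_(x : {ffun 'I_s -> G}) #|common_nbrs x|%:R :> R.
Proof.
move=> big; have [n0|n_gt0] := posnP (vcard G).
  by rewrite n0 mul0r mulr0 mul0r sumr_ge0.
have al_gt0 := indep_num_gt0 n_gt0.
set al := indep_num G in big al_gt0 *; set n := vcard G in big n_gt0 *.
set t : R := n%:R / _.
pose k := (n %/ (2 * al))%N.
have k_gt0 : (0 < k)%N by rewrite divn_gt0 ?muln_gt0.
have small : (2 * (al * k) <= n)%N by rewrite mulnA mulnC leq_trunc_div.
have n_le : (n <= 4 * al * k)%N.
  have := ltn_ceil n (_ : 0 < 2 * al)%N; rewrite muln_gt0 al_gt0 => /(_ isT).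
  rewrite -/k => /ltnW /leq_trans; apply.
  by nia.
have := sum_card_common_nbrs_ge s small.
rewrite -/n -(ler_nat R) !natrM natr_sum natrX => dense.
suff : 4 * t * n%:R ^+ s <= n%:R * k%:R ^+ s by lra.
have al4_gt0 : 0 < 4 * al%:R :> R by rewrite mulr_gt0// ltr0n.
have -> : 4 * t = n%:R / (4 * al%:R) ^+ s.
  by rewrite /t invfM; field; rewrite gt_eqF// exprn_gt0.
rewrite -mulrA ler_wpM2l// mulrC ler_pdivrMr ?exprn_gt0// -exprMn.
rewrite lerXn2r ?nnegrE ?mulr_ge0 ?ler0n//.
by rewrite -!natrM ler_nat mulnC.
Qed.

(** The assumption [a <= 1] makes the exponent at most [1], which settles the
    case where the independence number is linear in the order. *)
Lemma RS_join_empty (s : nat) (H : sgraph) (a : R) :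
  (0 < ecard H)%N -> 0 < a -> a <= 1 ->
  RS H a -> RS (join (empty_graph s) H) (a / (1 + s%:R * a)).
Proof.
move=> e_gt0 a_gt0 a_le1 /(RS_dichotomy _ e_gt0)[c c_gt0 hc].
have v_gt0 := ecard_gt0_vcard e_gt0.
pose J := join (empty_graph s) H.
have eJ_ge : (_ <= ecard J)%N := ecard_join_empty_ge s H.
have d_ge1 : 1 <= 1 + s%:R * a by rewrite lerDl mulr_ge0// ltW.
have d_gt0 : 0 < 1 + s%:R * a by apply: lt_le_trans d_ge1.
set b := a / _.
have b_le1 : b <= 1 by rewrite ler_pdivrMr// mul1r (le_trans a_le1).
(* In the case where [c * t ^ a <= alpha], substituting the value of [t] gives
   [n ^ a <= K * alpha ^ (1 + s a)], hence [c1 * n ^ b <= alpha].  In the other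
   case [c2] is [c] divided by the constant part of [(n / t) ^ v]. *)
pose K : R := (4 * 4 ^+ s) `^ a / c.
have K_gt0 : 0 < K by rewrite divr_gt0// powR_gt0 // mulr_gt0 ?exprn_gt0.
pose r : R := (1 + s%:R * a)^-1.
pose c1 : R := (K `^ r)^-1.
pose c2 : R := c / (4 * 4 ^+ s) ^+ vcard H.
have c2_gt0 : 0 < c2 by rewrite divr_gt0// exprn_gt0// mulr_gt0// exprn_gt0.
apply/RS_dichotomy; first by rewrite (leq_trans _ eJ_ge)// addn_gt0 e_gt0.
exists (Num.min 2^-1 (Num.min c1 c2)) => [|G n_gt0].
  by rewrite !lt_min c2_gt0 !invr_gt0 powR_gt0// andbT; lra.
set C := Num.min _ _.
have [C_half C_c1 C_c2] : [/\ C <= 2^-1, C <= c1 & C <= c2].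
  by rewrite !ge_min !lexx !orbT.
have al_gt0 := indep_num_gt0 n_gt0.
set n := vcard G in n_gt0 *; set al := indep_num G in al_gt0 *.
have nR_gt0 : 0 < n%:R :> R by rewrite ltr0n.
have alR_gt0 : 0 < al%:R :> R by rewrite ltr0n.
have [big|/ltnW al_large] := leqP (2 * al) n; last first.
  left; apply: le_trans (_ : 2^-1 * n%:R <= _).
    apply: ler_pM => //; rewrite ?powR_ge0//.
      by rewrite !le_min ltW ?invr_gt0 ?(ltW c2_gt0)// invr_ge0 powR_ge0.
    by apply: ler1_powR => //; rewrite ler1n.
  by move: al_large; rewrite -(ler_nat R) natrM; lra.
pose t : R := n%:R / (4 * (4 * al%:R) ^+ s).
have dense := common_nbrs_dense s big.
have t_gt0 : 0 < t by rewrite divr_gt0// mulr_gt0// exprn_gt0// mulr_gt0.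
have nE : n%:R = t * ((4 * 4 ^+ s) * al%:R ^+ s).
  by rewrite -mulrA -exprMn /t divfK// gt_eqF// mulr_gt0// exprn_gt0// mulr_gt0.
have [sparse|small] := leP (c * t `^ a) al%:R.
  left; apply: le_trans (_ : c1 * n%:R `^ b <= _).
    by rewrite ler_wpM2r ?powR_ge0.
  rewrite mulrC ler_pdivrMr ?powR_gt0//.
  have nK : n%:R `^ a <= K * al%:R `^ (1 + s%:R * a).
    have -> : al%:R `^ (1 + s%:R * a) = al%:R * (al%:R ^+ s) `^ a :> R.
      rewrite powRD ?(gt_eqF alR_gt0) ?implybT// powRr1 ?ltW//.
      by rewrite powRrM powR_mulrn// ltW.
    rewrite nE powRM ?mulr_ge0 ?exprn_ge0 ?(ltW t_gt0) ?(ltW alR_gt0)//.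
    rewrite powRM ?mulr_ge0 ?exprn_ge0 ?(ltW alR_gt0)//.
    apply: le_trans
      (_ : al%:R / c * ((4 * 4 ^+ s) `^ a * (al%:R ^+ s) `^ a) <= _).
      by rewrite ler_wpM2r ?mulr_ge0 ?powR_ge0// ler_pdivlMr// mulrC.
    rewrite le_eqVlt; apply/orP; left; apply/eqP; rewrite /K; ring.
  rewrite /b powRrM -/r.
  apply: le_trans (_ : (K * al%:R `^ (1 + s%:R * a)) `^ r <= _).
    by rewrite ge0_ler_powR ?nnegrE ?invr_ge0 ?mulr_ge0 ?powR_ge0
               ?(ltW K_gt0) ?(ltW d_gt0)// invr_ge0 ltW.
  rewrite powRM ?powR_ge0 ?(ltW K_gt0)// -powRrM mulfV ?gt_eqF//.
  rewrite powRr1 ?(ltW alR_gt0)//.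
  by rewrite mulrC.
right.
(* The independence number of an induced subgraph may be replaced by that of
   [G], which is at least as large. *)
have dich (A : {set G}) : (0 < #|A|)%N ->
    c * #|A|%:R `^ a <= al%:R \/
    c * #|A|%:R ^+ vcard H <= (hom_num H (induced A))%:R * al%:R ^+ ecard H.
  rewrite -vcard_induced => /hc[h|h]; [left|right]; apply: le_trans h _.
    by rewrite ler_nat indep_num_induced.
  rewrite ler_wpM2l// lerXn2r ?nnegrE// ler_nat.
  exact: indep_num_induced.
have := hom_num_join_large_nbrs v_gt0 (ltW a_gt0) c_gt0 t_gt0 dich small dense.
rewrite -/n -/al -/J vcard_join_empty => homJ.
apply: le_trans (_ : c2 * n%:R ^+ (s + vcard H) <= _).
  by rewrite ler_wpM2r ?exprn_ge0.
apply: le_trans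
  (_ : (hom_num J G)%:R * al%:R ^+ (ecard H + s * vcard H) <= _); last first.
  rewrite ler_wpM2l//; apply: ler_weXn2l => //.
  by rewrite ler1n.
rewrite [al%:R ^+ _]exprD mulrA.
apply: le_trans (ler_wpM2r _ homJ); last exact: exprn_ge0.
rewrite [n%:R ^+ (_ + _)]exprD [n%:R ^+ vcard H](_ : _ =
  t ^+ vcard H * (4 * 4 ^+ s) ^+ vcard H * al%:R ^+ (s * vcard H)); last first.
  by rewrite nE !exprMn -!exprM mulrA.
rewrite le_eqVlt; apply/orP; left; apply/eqP; rewrite /c2.
by field; rewrite expf_neq0// mulf_neq0 ?expf_neq0.
Qed.

Lemma RS_threshold_ub (H : sgraph) (a : R) :
  0 < a -> a <= 1 -> RS H a -> a <= RS_threshold R H.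
Proof.
move=> a_gt0 a_le1 ha; apply: ub_le_sup => //.
by exists 1 => x /= [].
Qed.

End Thresholds.

Theorem proposition9 (R : realType) (H : sgraph) (s : nat) :
  (0 < s)%N ->
  Ramsey_Sidorenko R H ->
  Ramsey_Sidorenko R (join (empty_graph s) H) /\
  RS_threshold R (join (empty_graph s) H) >=
    RS_threshold R H / (1 + s%:R * RS_threshold R H).
Proof.
move=> _ [e_gt0 [a a_gt0 ha]].
(* [RS_threshold] only takes exponents at most [1] into account. *)
pose a' := Num.min a 1.
have a'_gt0 : 0 < a' by rewrite lt_min a_gt0 ltr01.
have a'_le1 : a' <= 1 by rewrite ge_min lexx orbT.
have ha' : RS H a' by apply: (RS_le e_gt0 _ ha); rewrite ge_min lexx.
have b'_gt0 : 0 < a' / (1 + s%:R * a').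
  by rewrite divr_gt0// ltr_pwDl// mulr_ge0// ltW.
split.
  split.
    by rewrite (leq_trans _ (ecard_join_empty_ge s H))// addn_gt0 e_gt0.
  by exists (a' / (1 + s%:R * a')) => //; exact: RS_join_empty.
set a0 := RS_threshold R H.
set b0 := RS_threshold R _.
have f_le x : 0 < x -> x <= 1 -> RS H x -> x / (1 + s%:R * x) <= b0.
  move=> x_gt0 x_le1 hx; have d_gt0 : 0 < 1 + s%:R * x.
    by rewrite ltr_pwDl// mulr_ge0// ltW.
  apply: RS_threshold_ub; last exact: RS_join_empty.
    by rewrite divr_gt0.
  by rewrite ler_pdivrMr// mul1r (le_trans x_le1)// lerDl mulr_ge0// ltW.
have b0_ge0 : 0 <= b0 := le_trans (ltW b'_gt0) (f_le _ a'_gt0 a'_le1 ha').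
have a0_ge0 : 0 <= a0 :=
  le_trans (ltW a'_gt0) (RS_threshold_ub a'_gt0 a'_le1 ha').
rewrite ler_pdivrMr; last by rewrite ltr_pwDl// mulr_ge0.
apply: ge_sup; first by exists a'.
move=> x /= [x_gt0 x_le1 hx].
apply: le_trans (_ : b0 * (1 + s%:R * x) <= _).
  by rewrite -ler_pdivrMr ?f_le// ltr_pwDl// mulr_ge0// ltW.
rewrite ler_wpM2l// lerD2l ler_wpM2l//.
exact: RS_threshold_ub.
Qed.
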